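(* Let $\ell\in C([0,+\infty))$ be positive and differentiable with $|\ell'(t)|<1$ for all $t\ge 0$, and put $L=\ell(0)$. Suppose there is $\varphi\in C^1([-L,+\infty))$, real-valued, with $\varphi'>0$ on $[-L,+\infty)$ and $\varphi(t+\ell(t))-\varphi(t-\ell(t))=2$ for all $t\ge 0$. Let $u^0\in H^1(0,L)$ with $u^0(0)=0$ and $u^1\in L^2(0,L)$ be real-valued, and let $u$ be the solution of the undamped ($\eta=0$) problem $$\begin{cases} u_{tt}-u_{xx}=0, & 0<x<\ell(t),\ t>0,\\ u_x(\ell(t),t)+\ell'(t)\,u_t(\ell(t),t)=0, & t>0,\\ u(0,t)=0, & t>0,\\ u(x,0)=u^0(x),\quad u_t(x,0)=u^1(x), & 0<x<L.\end{cases}$$ Let $I\subset[0,+\infty)$ be an interval. If $-1<\ell'(t)\le 0$ for $t\in I$, then $E_\ell$ is nondecreasing on $I$; if $0\le\ell'(t)<1$ for $t\in I$, then $E_\ell$ is nonincreasing on $I$.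
   Context: Energy: $E_\ell(t):=\frac12\int_0^{\ell(t)}u_t^2(x,t)+u_x^2(x,t)\,dx$. Notion of solution: $u(x,t)=f(t+x)+g(t-x)$ with $f\in H^1(0,R)$ and $g\in H^1(-L,R)$ for every $R>0$, so $u_x=f'(t+x)-g'(t-x)$ and $u_t=f'(t+x)+g'(t-x)$; the boundary condition at $x=\ell(t)$ is required for almost every $t>0$ and the initial condition on $u_t$ for almost every $x\in(0,L)$. Such a solution exists and is unique. *)

(* Defs.v *)
From HB Require Import structures.
From mathcomp Require Import all_boot all_order all_algebra.
From mathcomp Require Import all_classical all_reals all_analysis.

Set Implicit Arguments.
Unset Strict Implicit.
Unset Printing Implicit Defensive.
Import Order.TTheory GRing.Theory Num.Theory.
Import numFieldNormedType.Exports.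

Local Open Scope classical_set_scope.
Local Open Scope ring_scope.

(* Derivative relative to A: two-sided at interior points of A, one-sided at
   an endpoint that belongs to A. *)
Definition is_derive_within (R : realType) (A : set R) (f : R -> R) (t d : R) :
  Prop :=
  (fun s => (f s - f t) / (s - t)) @ within A t^' --> d.

Definition L2 (R : realType) (a b : R) (f : R -> R) : Prop :=
  f \_ `]a, b[ \in Lfun (@lebesgue_measure R) 2%:E.

(* Test functions: C^1 on the line with compact support inside (a, b). *)
Definition C1c (R : realType) (a b : R) (psi : R -> R) : Prop :=
  [/\ forall x, derivable psi x 1,
      continuous (derive1 psi)
    & exists c d, [/\ a < c, d < b & forall x, x \notin `[c, d] -> psi x = 0]].

Definition weak_derivative (R : realType) (a b : R) (f df : R -> R) : Prop :=
  forall psi, C1c a b psi ->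
    \int[lebesgue_measure]_(x in `]a, b[) (f x * derive1 psi x) =
    - \int[lebesgue_measure]_(x in `]a, b[) (df x * psi x).

(* f is the representative, continuous on [a, b], of an element of the Sobolev
   space H^1(a, b), and df is a representative of its weak derivative. *)
Definition H1_deriv (R : realType) (a b : R) (f df : R -> R) : Prop :=
  [/\ {within `[a, b], continuous f},
      L2 a b f, L2 a b df & weak_derivative a b f df].

Definition H1 (R : realType) (a b : R) (f : R -> R) : Prop :=
  exists df, H1_deriv a b f df.

(* u is the solution, with first derivatives ut and ux, of the undamped wave
   equation on 0 < x < l t; dl stands for the derivative of l.  The equation
   u_tt - u_xx = 0 is expressed by d'Alembert's formula, with the weak
   derivatives df and dg giving the values of ux and ut. *)
Definition wave_solution (R : realType) (l dl u0 u1 : R -> R)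
    (u ut ux : R -> R -> R) : Prop :=
  [/\ exists f df g dg : R -> R,
        [/\ forall r, 0 < r -> H1_deriv 0 r f df,
            forall r, 0 < r -> H1_deriv (- l 0) r g dg
          & forall x t, 0 <= t -> 0 <= x <= l t ->
              [/\ u x t = f (t + x) + g (t - x),
                  ux x t = df (t + x) - dg (t - x)
                & ut x t = df (t + x) + dg (t - x)]],
      {ae lebesgue_measure, forall t : R,
        0 < t -> ux (l t) t + dl t * ut (l t) t = 0},
      forall t, 0 < t -> u 0 t = 0,
      forall x, 0 < x < l 0 -> u x 0 = u0 x
    & {ae lebesgue_measure, forall x : R, 0 < x < l 0 -> ut x 0 = u1 x}].

Definition energy (R : realType) (l : R -> R) (ut ux : R -> R -> R) (t : R) :
  R :=
  2^-1 * \int[lebesgue_measure]_(x in `]0, l t[) (ut x t ^+ 2 + ux x t ^+ 2).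

(* Main.v *)
(* Since u vanishes at x = 0, g = - f on ]0, +oo[, and the energy at time t is the
   integral of g'^2 over ]b t, a t[, where a t = t + l t and b t = t - l t.  Hence
   E t - E s is the integral of g'^2 over ]a s, a t[ minus that over ]b s, b t[,
   that is the integral over ]s, t[ of a' (g' o a)^2 - b' (g' o b)^2.  The boundary
   condition reads a' (g' o a) = - b' (g' o b) almost everywhere, so the integrand
   is (g' o b)^2 b' (b' - a') / a', whose sign is that of b' - a' = - 2 l'.  The
   function phi makes l of class C^1, which justifies the changes of variables. *)
Require Import Defs.
From HB Require Import structures.
From mathcomp Require Import all_boot all_order all_algebra.
From mathcomp Require Import all_classical all_reals all_analysis.
From mathcomp Require Import measurable_realfun.
From mathcomp Require Import ring lra.
Set Implicit Arguments.
Unset Strict Implicit.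
Unset Printing Implicit Defensive.
Import Order.TTheory GRing.Theory Num.Theory.
Import numFieldNormedType.Exports.
Local Open Scope classical_set_scope.
Local Open Scope ring_scope.

(** The profiles are only of class H^1, so [f'] and [g'] are square integrable functions known up to
    null sets, and this creates three obstacles. Passing from [g = - f] to [g' = - f'] is the
    uniqueness of weak derivatives, obtained by testing against explicit C^1 bumps. The change of
    variables must hold for a nonnegative integrand that is merely measurable, so it is proved as an
    equality of measures. Finally, d'Alembert's formula turns the boundary condition into
    [a' (f' o a) = b' (g' o b)]; replacing [f'] by [- g'] there uses an almost-everywhere identity
    at the point [a t], so its exceptional set has to be pulled back along [a]. The preimage is null
    because [a' > 0]. Integrals of [g' ^ 2] are taken in the extended reals; they are finite because
    [g'] is square integrable on each []- L, r[], and only then are energies subtracted. *)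

Lemma measurable_itvR (R : realType) (i : interval R) :
  measurable ([set` i] : set (measurableTypeR R)).
Proof. exact: measurable_itv. Qed.

Lemma is_derive_slope (R : realType) (f : R -> R) (x df : R) :
  h^-1 * (f (h + x) - f x) @[h --> 0^'] --> df -> is_derive x 1 f df.
Proof.
move=> fdf.
have fE : (fun h => h^-1 *: ((f \o shift x) (h *: 1) - f x)) =
    (fun h => h^-1 * (f (h + x) - f x)).
  by apply/funext => h /=; rewrite [h *: 1]mulr1.
split; first by apply/cvg_ex; exists df; rewrite fE.
by apply/cvg_lim => //; rewrite fE.
Qed.

Lemma is_derive_within_interior (R : realType) (A : set R) (f : R -> R) (x df : R) :
  nbhs x A -> is_derive_within A f x df -> is_derive x 1 f df.
Proof.
move=> xA /cvgrPdist_lt fdf; apply: is_derive_slope; apply/cvgrPdist_lt => e e0.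
have := fdf e e0; move: xA => /nbhs_ballP[r /= r0 xrA].
rewrite !near_withinE => /nbhs_ballP[d /= d0 xd].
apply/nbhs_ballP; exists (Num.min d r) => /=; first by rewrite lt_min d0 r0.
move=> h /=; rewrite /ball/= sub0r normrN lt_min => /andP[hd hr] h0.
have -> : h^-1 * (f (h + x) - f x) = (f (h + x) - f x) / ((h + x) - x).
  by rewrite addrK mulrC.
have xhE : `|x - (h + x)| = `|h| by rewrite opprD addrCA subrr addr0 normrN.
apply: xd; rewrite /ball/= ?xhE//; last first.
  by apply: xrA; rewrite /ball/= xhE.
by rewrite -subr_eq0 addrK.
Qed.

(** * Uniqueness of weak derivatives *)

Section bump.
Context (R : realType).
Implicit Types (x y c d : R) (n : nat).

(** Squaring removes the corner of the positive part: at [0] the difference quotient is at most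
    [|h|] in absolute value. *)
Lemma is_derive_sqr_max0 y :
  is_derive y 1 (fun z : R => Num.max 0 z ^+ 2) (2 * Num.max 0 y).
Proof.
have [y0|y0|<-] := ltgtP 0 y.
- apply: (@near_eq_is_derive R R^o R^o (fun z => z ^+ 2)).
    near=> z; rewrite max_r// ltW//; near: z.
    by apply: lt_nbhsr.
  have := @is_deriveX _ _ (@id R) 2 y 1 1 (is_derive_id _ _).
  by rewrite /= expr1 [_ *: 1]mulr1.
- apply: (@near_eq_is_derive R R^o R^o (fun z => 0)).
    near=> z; rewrite max_l ?expr0n// ltW//; near: z.
    by apply: lt_nbhsl.
  by rewrite mulr0; exact: is_derive_cst.
- have norm_cvg0 : `|h| @[h --> (0:R)^'] --> (0:R).
    rewrite -[X in _ --> X](@normr0 _ R); apply: cvg_norm.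
    exact: cvg_within.
  apply: is_derive_slope.
  rewrite mulr0 maxxx expr0n/=.
  apply: (@squeeze_cvgr _ _ _ _ (fun h => - `|h|) (fun h : R => `|h|)).
  + near=> h; rewrite addr0 subr0 -ler_norml normrM normfV normrX.
    have h0 : h != 0 by near: h; exact: nbhs_dnbhs_neq.
    rewrite mulrC ler_pdivrMr ?normr_gt0// -expr2 ler_sqr ?nnegrE//.
    by rewrite ger0_norm ?le_max ?lexx// ge_max normr_ge0 ler_norm.
  + by rewrite -[X in _ --> X]oppr0; exact: cvgN.
  + exact: norm_cvg0.
Unshelve. all: by end_near. Qed.

(* n q / (1 + n q) with q = max (0, (x - c) (d - x)) ^ 2, a C^1 function, so that
   the limit in n is the indicator function of ]c, d[. *)
Definition bump c d n x : R :=
  1 - (1 + n%:R * Num.max 0 ((x - c) * (d - x)) ^+ 2)^-1.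

Definition dbump c d n x : R :=
  n%:R * (2 * Num.max 0 ((x - c) * (d - x)) * (c + d - 2 * x)) /
  (1 + n%:R * Num.max 0 ((x - c) * (d - x)) ^+ 2) ^+ 2.

Let denom_gt0 c d n x : 0 < 1 + n%:R * Num.max 0 ((x - c) * (d - x)) ^+ 2.
Proof. by rewrite ltr_pwDl// mulr_ge0// sqr_ge0. Qed.

Lemma is_derive_bump c d n x : is_derive x 1 (bump c d n) (dbump c d n x).
Proof.
pose p z : R := (z - c) * (d - z).
have dp : is_derive x 1 p (c + d - 2 * x).
  have : is_derive x 1 ((@id R - cst c) * (cst d - @id R))
      ((x - c) *: (0 - 1) + (d - x) *: (1 - 0)).
    exact: is_deriveM.
  move/is_derive_eq; apply; rewrite /GRing.scale/=; ring.
pose q := (fun z : R => Num.max 0 z ^+ 2) \o p.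
have dq : is_derive x 1 q (2 * Num.max 0 (p x) * (c + d - 2 * x)).
  exact: is_derive1_comp (is_derive_sqr_max0 _) dp.
pose r z : R := 1 + n%:R * Num.max 0 ((z - c) * (d - z)) ^+ 2.
have dr : is_derive x 1 r (0 + n%:R *: (2 * Num.max 0 (p x) * (c + d - 2 * x))).
  have -> : r = cst 1 + n%:R *: q by apply/funext.
  exact: is_deriveD.
have drV := @is_deriveV R r x _ _ (lt0r_neq0 (denom_gt0 c d n x)) dr.
have : is_derive x 1 (cst 1 - (fun z => (r z)^-1))
    (0 - (- r x ^- 2 *: (0 + n%:R *: (2 * Num.max 0 (p x) * (c + d - 2 * x))))).
  exact: is_deriveB.
move/is_derive_eq; apply.
by rewrite sub0r scaleNr opprK add0r [LHS]mulrC.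
Qed.

Lemma continuous_dbump c d n : continuous (dbump c d n).
Proof.
have cp : continuous (fun x => (x - c) * (d - x)).
  move=> x; apply: (@cvgM _ _ _ _ (fun y : R => y - c) (fun y : R => d - y)).
    by apply: cvgB; [exact: cvg_id|exact: cvg_cst].
  by apply: cvgB; [exact: cvg_cst|exact: cvg_id].
have cm : continuous (fun x => Num.max 0 ((x - c) * (d - x))).
  move=> x; exact: (@continuous_max R R (cst 0) (fun x => (x - c) * (d - x)) x
    (@cst_continuous R R 0 x) (cp x)).
move=> x; rewrite /dbump; apply: cvgM.
  apply: cvgM; first exact: cvg_cst.
  apply: cvgM; first by apply: cvgM; [exact: cvg_cst|exact: cm].
  apply: cvgB; first exact: cvg_cst.
  by apply: cvgM; [exact: cvg_cst|exact: cvg_id].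
apply: cvgV; first by rewrite expf_neq0// lt0r_neq0// denom_gt0.
apply: (@cvg_comp _ _ _
  (fun y => 1 + n%:R * Num.max 0 ((y - c) * (d - y)) ^+ 2) (fun z => z ^+ 2));
  last exact: exprn_continuous.
apply: cvgD; first exact: cvg_cst.
apply: cvgM; first exact: cvg_cst.
apply: (@cvg_comp _ _ _
  (fun y => Num.max 0 ((y - c) * (d - y))) (fun z => z ^+ 2)); first exact: cm.
exact: exprn_continuous.
Qed.

Let max0_notin_itv c d x : (x <= c) || (d <= x) ->
  c <= d -> Num.max 0 ((x - c) * (d - x)) = 0.
Proof.
move=> xcd cd; rewrite max_l// -oppr_ge0; case/orP : xcd => ?.
  by rewrite -mulNr opprB mulr_ge0// subr_ge0// (le_trans _ cd).
by rewrite -mulrN opprB mulr_ge0// subr_ge0// (le_trans cd).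
Qed.

Lemma C1c_bump (a b c d : R) n :
  a < c -> c <= d -> d < b -> C1c a b (bump c d n).
Proof.
move=> ac cd db; split.
- by move=> x; have [] := is_derive_bump c d n x.
- rewrite (_ : derive1 (bump c d n) = dbump c d n); first exact: continuous_dbump.
  apply/funext => x; rewrite derive1E.
  exact: (@derive_val _ _ _ _ _ _ _ (is_derive_bump c d n x)).
- exists c, d; split => // x; rewrite in_itv/= negb_and -!ltNge => xcd.
  rewrite /bump max0_notin_itv ?expr0n ?mulr0 ?addr0 ?invr1 ?subrr//.
  by case/orP : xcd => /ltW ->; rewrite ?orbT.
Qed.

Lemma bump_ge0_le1 c d n x : 0 <= bump c d n x <= 1.
Proof.
rewrite /bump subr_ge0 lerBlDr lerDl invr_ge0 (ltW (denom_gt0 _ _ _ _)) andbT.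
by rewrite invf_le1 ?denom_gt0// lerDl mulr_ge0// sqr_ge0.
Qed.

Lemma bump_cvg c d x : c <= d ->
  bump c d n x @[n --> \oo] --> (\1_(`]c, d[%classic : set R) x : R).
Proof.
move=> cd; rewrite indicE; case: (boolP (x \in _)) => [/set_mem/=|/negP xcd];
  last first.
  rewrite /bump max0_notin_itv//.
    under eq_fun do rewrite expr0n/= mulr0 addr0 invr1 subrr.
    exact: cvg_cst.
  apply: contrapT => /negP; rewrite negb_or -!ltNge => cxd.
  by apply: xcd; rewrite inE /= in_itv.
rewrite in_itv/= => /andP[cx xd].
have q0 : 0 < Num.max 0 ((x - c) * (d - x)) ^+ 2.
  by rewrite exprn_gt0// lt_max mulr_gt0 ?subr_gt0// orbT.
rewrite /bump -[X in _ --> X]subr0; apply: cvgB; first exact: cvg_cst.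
apply/cvgrVy; first by apply: nearW => n; rewrite invr_gt0 denom_gt0.
apply/cvgryPge => M; near=> n; rewrite /= invrK.
rewrite (@le_trans _ _ (n%:R * Num.max 0 ((x - c) * (d - x)) ^+ 2))//; last first.
  by rewrite lerDr.
rewrite -ler_pdivrMr//; near: n; exact: nbhs_infty_ger.
Unshelve. all: by end_near. Qed.

End bump.

Section weak_derivative.
Context (R : realType).
Notation mu := (@lebesgue_measure R).
Implicit Types (a b c d : R) (f df g dg h psi : R -> R).

Lemma L2_measurable a b h : L2 a b h -> measurable_fun `]a, b[ h.
Proof.
by move=> /sub_Lfun_mfun /set_mem h2; apply/measurable_restrictT.
Qed.

Lemma L2_integrable_sqr a b h :
  L2 a b h -> mu.-integrable `]a, b[ (EFin \o (fun x => h x ^+ 2)).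
Proof.
move=> /Lfun2_integrable_sqr h2; apply/integrable_mkcond => //.
apply: eq_integrable h2 => // x _ /=.
by rewrite !patchE; case: ifPn => // _; rewrite expr0n.
Qed.

Lemma bounded_integrable_itv a b h : measurable_fun `]a, b[ h ->
  [bounded h x | x in `]a, b[%classic] -> mu.-integrable `]a, b[ (EFin \o h).
Proof.
move=> mh bh; apply: measurable_bounded_integrable => //.
by rewrite /= lebesgue_measure_itv/=; case: ifPn => // _; rewrite -EFinD ltry.
Qed.

(** A bounded interval has finite measure, so [1 + h ^ 2] is integrable; it dominates [|h|] because
    the square of [|h| - 1/2] is nonnegative. *)
Lemma L2_integrable a b h : L2 a b h -> mu.-integrable `]a, b[ (EFin \o h).
Proof.
move=> h2; have mh := L2_measurable h2.
have i1 : mu.-integrable `]a, b[ (EFin \o (cst 1 : R -> R)).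
  apply: bounded_integrable_itv; first exact: measurable_cst.
  exists 1; split => // x x1 y _; apply: ltW; move: x1; congr (_ < _).
  by rewrite /= normr1.
have := integrableD (measurable_itvR _) i1 (L2_integrable_sqr h2).
apply: le_integrable => //; first exact/measurable_EFinP.
move=> x _; rewrite /= lee_fin [leRHS]ger0_norm ?addr_ge0 ?sqr_ge0//.
rewrite -(real_normK (num_real (h x))); have := sqr_ge0 (`|h x| - 2^-1); nra.
Qed.

Lemma bounded_continuous_itv a b psi : continuous psi ->
  [bounded psi x | x in `]a, b[%classic].
Proof.
move=> cpsi.
have /compact_bounded[M [Mr psiM]] : compact (psi @` `[a, b]).
  apply: continuous_compact (@segment_compact _ _ _).
  exact: continuous_subspaceT.
exists M; split => // x Mx y yab; apply: psiM Mx _ _.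
by exists y => //; exact: subset_itv_oo_cc yab.
Qed.

Lemma integrableM_continuous a b h psi : continuous psi ->
  mu.-integrable `]a, b[ (EFin \o h) ->
  mu.-integrable `]a, b[ (EFin \o (fun x => h x * psi x)).
Proof.
move=> cpsi ih.
have mpsi : measurable_fun `]a, b[ psi.
  by apply: measurable_funTS; exact: continuous_measurable_fun.
have := integrableMl (measurable_itvR _) ih mpsi
  (@bounded_continuous_itv a b psi cpsi).
by apply: eq_integrable => // x _ /=; rewrite EFinM.
Qed.

Lemma C1c_continuous a b psi : C1c a b psi -> continuous psi.
Proof.
by move=> [dpsi _ _] x; apply/differentiable_continuous/derivable1_diffP/dpsi.
Qed.

(** The support lies in a closed interval strictly inside []a, b[], so [psi] vanishes on a whole
    neighbourhood of [x], even when [x] is an endpoint. *)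
Lemma C1c_derive_out a b psi x : C1c a b psi -> x \notin `]a, b[ ->
  psi x = 0 /\ derive1 psi x = 0.
Proof.
move=> [dpsi _ [c [d [ac db psi0]]]] xab.
have xcd : x \notin `[c, d].
  apply: contra xab; rewrite !in_itv/= => /andP[cx xd].
  by rewrite (lt_le_trans ac cx) (le_lt_trans xd db).
split; first exact: psi0.
rewrite derive1E -(@derive_cst _ _ _ (0 : R) x 1); apply: near_eq_derive.
have : nbhs x (~` `[c, d]).
  apply: open_nbhs_nbhs; split; last by apply/negP.
  by apply: closed_openC; exact: interval_closed.
by apply: filterS => y /negP; exact: psi0.
Qed.

(** A test function of the smaller interval is one of the larger, and both integrands vanish outside
    the smaller. This brings [g], given on []- l 0, r[], to the interval []0, r[] of [f]. *)
Lemma weak_derivative_sub a b c d f df : a <= c -> d <= b ->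
  weak_derivative a b f df -> weak_derivative c d f df.
Proof.
move=> ac db wf psi psiC.
have psiC' : C1c a b psi.
  case: psiC => dpsi cpsi [x [y [cx yd psi0]]]; split => //.
  by exists x, y; split => //; [exact: le_lt_trans cx|exact: lt_le_trans db].
have sub h0 psi0 : (forall x, x \notin `]c, d[ -> psi0 x = 0) ->
    \int[mu]_(x in `]a, b[) (h0 x * psi0 x) =
    \int[mu]_(x in `]c, d[) (h0 x * psi0 x).
  move=> psi00; rewrite Rintegral_mkcond [RHS]Rintegral_mkcond; congr Rintegral.
  apply/funext => x; rewrite !patchE.
  have [xcd|xcd] := boolP (x \in `]c, d[).
    rewrite !mem_set//=; move: xcd; rewrite !in_itv/= => /andP[cx xd].
    by rewrite (le_lt_trans ac cx) (lt_le_trans xd db).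
  by rewrite psi00// mulr0 !if_same.
have := wf psi psiC'; rewrite !sub// => x xcd.
- by case: (C1c_derive_out psiC xcd).
- by case: (C1c_derive_out psiC xcd).
Qed.

End weak_derivative.

Section du_bois_reymond.
Context (R : realType).
Notation mu := (@lebesgue_measure R).
Implicit Types (a b c d : R) (f df g dg h psi : R -> R).

(** The bumps are test functions with values in [[0, 1]] that tend to the indicator function of []c,
    d[]; dominated convergence applies with bound [|h|]. *)
Lemma C1c_orthogonal_itv a b c d h : mu.-integrable `]a, b[ (EFin \o h) ->
  (forall psi, C1c a b psi -> \int[mu]_(x in `]a, b[) (h x * psi x) = 0) ->
  a < c -> c <= d -> d < b -> \int[mu]_(x in `]c, d[) h x = 0.
Proof.
move=> ih h0 ac cd db.
have mh : measurable_fun `]a, b[ h.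
  by apply/measurable_EFinP; exact: measurable_int ih.
have cbump n : continuous (bump c d n).
  exact: (C1c_continuous (C1c_bump n ac cd db)).
have ihb n := integrableM_continuous (cbump n) ih.
have cdab : `]c, d[ `<=` `]a, b[.
  move=> x /=; rewrite !in_itv/= => /andP[cx xd].
  by rewrite (lt_trans ac)// (lt_trans xd).
have [] := @dominated_convergence _ _ _ mu `]a, b[%classic (measurable_itvR _)
  (fun n x => (h x * bump c d n x)%:E)
  (fun x => (h x * \1_(`]c, d[%classic : set R) x)%:E)
  (fun x => `|h x|%:E).
- by move=> n; exact: measurable_int (ihb n).
- apply/measurable_EFinP; apply: measurable_funM => //.
- apply: nearW => x _; apply: cvg_EFin; first exact: nearW.
  by apply: cvgM; [exact: cvg_cst|exact: bump_cvg].
- exact: integrable_abse ih.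
- apply: nearW => x n _; rewrite lee_fin normrM ler_piMr//.
  by have /andP[? ?] := bump_ge0_le1 c d n x; rewrite ger0_norm.
move=> _ _ cvg_int.
have int0 n : (\int[mu]_(x in `]a, b[) (h x * bump c d n x)%:E = 0)%E.
  rewrite -[LHS]fineK; last exact: integrable_fin_num (ihb n).
  by congr EFin; exact: h0 (C1c_bump n ac cd db).
rewrite /Rintegral.
have -> : (\int[mu]_(x in `]c, d[) (h x)%:E =
    \int[mu]_(x in `]a, b[) (h x * \1_(`]c, d[%classic : set R) x)%:E)%E.
  rewrite -(setIidr cdab) integral_mkcondr; apply: eq_integral => x _.
  by rewrite patchE indicE (setIidr cdab); case: (x \in _); rewrite ?mulr1 ?mulr0.
suff -> : (\int[mu]_(x in `]a, b[)
    (h x * \1_(`]c, d[%classic : set R) x)%:E = 0)%E by [].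
have seq0 : (fun n => \int[mu]_(x in `]a, b[) (h x * bump c d n x)%:E)%E = (fun=> 0%E).
  by apply/funext.
move: cvg_int => /cvg_lim <-//; rewrite seq0.
by apply/cvg_lim => //; exact: cvg_cst.
Qed.

(** Cut off outside []c, d[], [h] has a primitive that vanishes identically, each of its values
    being an integral over a subinterval of []c, d[]. Lebesgue differentiation then recovers [h]
    almost everywhere. *)
Lemma ae_eq0_C1c_orthogonal_sub a b c d h : mu.-integrable `]a, b[ (EFin \o h) ->
  (forall psi, C1c a b psi -> \int[mu]_(x in `]a, b[) (h x * psi x) = 0) ->
  a < c -> d < b -> {ae mu, forall x, c < x < d -> h x = 0}.
Proof.
move=> ih h0 ac db.
have cdab : `]c, d[ `<=` `]a, b[.
  move=> x /=; rewrite !in_itv/= => /andP[cx xd].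
  by rewrite (lt_trans ac)// (lt_trans xd).
have ihcd := integrableS (measurable_itvR _) (measurable_itvR _) cdab ih.
have mhcd : measurable_fun `]c, d[ h.
  by apply/measurable_EFinP; exact: measurable_int ihcd.
pose H := h \_ `]c, d[.
have iH : mu.-integrable [set: R] (EFin \o H).
  by move: ihcd => /(integrable_mkcond _ (measurable_itvR _)); rewrite restrict_EFin.
have H0 x : \int[mu]_(y in `]-oo, x]) H y = 0.
  rewrite -Rintegral_mkcondr.
  have [xc|cx] := leP x c.
    rewrite (_ : _ `&` _ = set0) ?Rintegral_set0//.
    apply/seteqP; split=> // y [] /=; rewrite !in_itv/= => yx /andP[cy _].
    by have := lt_le_trans cy (le_trans yx xc); rewrite ltxx.
  have [dx|xd] := leP d x.
    rewrite (_ : _ `&` _ = `]c, d[%classic).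
      have [cd|dc] := leP c d; first exact: C1c_orthogonal_itv ih h0 ac cd db.
      by rewrite set_itv_ge ?Rintegral_set0// -leNgt bnd_simp ltW.
    apply/seteqP; split=> y /=; first by move=> [].
    rewrite !in_itv/= => /andP[cy yd]; rewrite cy yd; split => //.
    by rewrite (le_trans (ltW yd)).
  rewrite (_ : _ `&` _ = `]c, x]%classic).
    rewrite -Rintegral_itv_bndo_bndc.
      exact: C1c_orthogonal_itv ih h0 ac (ltW cx) (lt_trans xd db).
    apply: integrableS ihcd => //.
    by move=> y /=; rewrite !in_itv/= => /andP[-> yx]; rewrite (lt_trans yx).
  apply/seteqP; split=> y /=; rewrite !in_itv/=; first by move=> [-> /andP[-> _]].
  by move=> /andP[-> yx]; rewrite yx (le_lt_trans yx).
have iHy y : mu.-integrable `]-oo, y] (EFin \o H) by exact: integrableS iH.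
have := FTC1Ny iHy (integrable_locally (measurable_itvR _) ihcd).
have -> : (fun x => \int[mu]_(t in `]-oo, x]) H t) = cst 0 by apply/funext.
apply: filterS; first exact: (ae_filter_ringOfSetsType mu).
move=> x [_ +] xcd; rewrite derive1_cst /H patchE mem_set//.
Qed.

(** Countably many intervals, with margin [1 / (n + 1)] at both ends, exhaust []a, b[]. *)
Lemma ae_eq0_C1c_orthogonal a b h : mu.-integrable `]a, b[ (EFin \o h) ->
  (forall psi, C1c a b psi -> \int[mu]_(x in `]a, b[) (h x * psi x) = 0) ->
  {ae mu, forall x, a < x < b -> h x = 0}.
Proof.
move=> ih h0; pose e n : R := n.+1%:R^-1.
have e0 n : 0 < e n by rewrite invr_gt0.
have : {ae mu, forall x, forall n, a + e n < x < b - e n -> h x = 0}.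
  apply: ae_foralln => n; apply: ae_eq0_C1c_orthogonal_sub ih h0 _ _.
    by rewrite ltrDl.
  by rewrite ltrBlDr ltrDl.
apply: filterS; first exact: (ae_filter_ringOfSetsType mu).
move=> x hx /andP[ax xb].
have m0 : 0 < Num.min (x - a) (b - x) by rewrite lt_min !subr_gt0 ax.
have [n _ /(_ n (leqnn n))] := near_infty_natSinv_lt (PosNum m0).
rewrite /= lt_min => /andP[en1 en2]; apply: (hx n).
by rewrite -ltrBrDl en1 ltrBrDr -ltrBrDl.
Qed.

(** Against any test function, [df + dg] integrates to minus the integral of [(f + g) psi'], which
    is zero. *)
Lemma ae_addr_eq0_weak_derivative a a' b f df g dg : a' <= a ->
  H1_deriv a b f df -> H1_deriv a' b g dg ->
  (forall x, a < x < b -> f x + g x = 0) ->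
  {ae mu, forall x, a < x < b -> df x + dg x = 0}.
Proof.
move=> a'a [_ f2 df2 wf] [_ g2 dg2 wg] fg0.
have sub : `]a, b[ `<=` `]a', b[.
  by move=> x /=; rewrite !in_itv/= => /andP[/(le_lt_trans a'a) -> ->].
have i1 := L2_integrable f2; have i2 := L2_integrable df2.
have i3 :=
  integrableS (measurable_itvR _) (measurable_itvR _) sub (L2_integrable g2).
have i4 :=
  integrableS (measurable_itvR _) (measurable_itvR _) sub (L2_integrable dg2).
apply: ae_eq0_C1c_orthogonal.
  by have := integrableD (measurable_itvR _) i2 i4; exact: eq_integrable.
move=> psi psiC; have cpsi := C1c_continuous psiC.
have cdpsi : continuous (derive1 psi) by case: psiC.
under eq_Rintegral do rewrite mulrDl.
rewrite RintegralD//; [|exact: integrableM_continuous..].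
have := wf _ psiC; have := weak_derivative_sub a'a (lexx b) wg psiC.
move=> /eqP; rewrite -eqr_oppLR => /eqP <- /eqP; rewrite -eqr_oppLR => /eqP <-.
rewrite -opprD -RintegralD//; [|exact: integrableM_continuous..].
rewrite (_ : Rintegral _ _ _ = 0) ?oppr0//.
under eq_Rintegral => x /[!inE] xab.
  rewrite -mulrDl fg0; last by move: xab; rewrite /= in_itv.
  rewrite mul0r; over.
by rewrite Rintegral_cst// mul0r.
Qed.

End du_bois_reymond.

(** * Substitution for measurable integrands *)

Section density_measure.
Local Open Scope ereal_scope.
Context d (T : measurableType d) (R : realType).
Variables (mu : {measure set T -> \bar R}) (w : T -> R).
Hypotheses (w_ge0 : forall x, (0 <= w x)%R) (mw : measurable_fun setT w).

Definition density_measure (A : set T) : \bar R := \int[mu]_(x in A) (w x)%:E.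

Let density_measure0 : density_measure set0 = 0.
Proof. by rewrite /density_measure integral_set0. Qed.

Let density_measure_ge0 A : 0 <= density_measure A.
Proof. by apply: integral_ge0 => x _; rewrite lee_fin. Qed.

Let density_measure_sigma_additive : semi_sigma_additive density_measure.
Proof.
move=> /= F mF tF mUF; rewrite /density_measure; apply: cvg_toP.
  apply: ereal_nondecreasing_is_cvgn => m n mn.
  by apply: lee_sum_nneg_natr => // k _ _; exact: density_measure_ge0.
rewrite ge0_integral_bigcup//= => [|x _]; last by rewrite lee_fin.
exact/measurable_EFinP/measurable_funTS.
Qed.

HB.instance Definition _ := isMeasure.Build _ _ _ density_measure
  density_measure0 density_measure_ge0 density_measure_sigma_additive.

Import HBNNSimple.

(** For an indicator function this is the definition of the measure; linearity gives simple
    functions, and monotone convergence along [nnsfun_approx] gives the rest. *)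
Let ge0_integral_density_measure (D : set T) (f : T -> \bar R) :
  measurable D -> measurable_fun D f -> (forall x, D x -> 0 <= f x) ->
  \int[density_measure]_(x in D) f x = \int[mu]_(x in D) (f x * (w x)%:E).
Proof.
move=> mD mf f0; pose h := nnsfun_approx mD mf.
have hf x : D x -> (h n x)%:E @[n --> \oo] --> f x.
  by move=> Dx; exact: cvg_nnsfun_approx.
have mh n : measurable_fun D (EFin \o h n).
  exact/measurable_EFinP/measurable_funTS/measurable_funP.
have mwE : measurable_fun D (EFin \o w).
  exact/measurable_EFinP/measurable_funTS.
have hnd x : D x -> {homo (fun n => (h n x)%:E) : m n / (m <= n)%N >-> m <= n}.
  by move=> _ m n mn; rewrite lee_fin; exact/lefP/nd_nnsfun_approx.
transitivity (lim (\int[density_measure]_(x in D) (h n x)%:E @[n --> \oo])).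
  rewrite -monotone_convergence//.
  - by apply: eq_integral => x /[!inE] Dx; apply/esym/cvg_lim => //; exact: hf.
  - by move=> n x _; rewrite lee_fin.
transitivity (lim (\int[mu]_(x in D) ((h n x)%:E * (w x)%:E) @[n --> \oo]));
  last first.
  rewrite -monotone_convergence//.
  - apply: eq_integral => x /[!inE] Dx; apply/cvg_lim => //.
    by apply: cvgeZr => //; exact: hf.
  - move=> n; apply: emeasurable_funM; [exact: mh|exact: mwE].
  - by move=> n x _; rewrite -EFinM lee_fin mulr_ge0.
  - move=> x Dx m n mn; apply: lee_wpmul2r; first by rewrite lee_fin.
    exact: hnd.
congr (lim (_ @ \oo)); apply/funext => n.
have mhk k : measurable (h n @^-1` [set k]) by [].
transitivity (\sum_(k \in range (h n))
    \int[density_measure]_(x in D) (k * \1_(h n @^-1` [set k]) x)%:E).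
  under eq_integral do rewrite fimfunE -fsumEFin//.
  rewrite ge0_integral_fsum//; last first.
    by move=> y x _; rewrite nnfun_muleindic_ge0.
  by move=> y; exact/measurable_EFinP/measurable_funM.
transitivity (\sum_(k \in range (h n))
    \int[mu]_(x in D) ((k * \1_(h n @^-1` [set k]) x)%:E * (w x)%:E)).
  apply: eq_fsbigr => k /[!inE] -[x _ hxk].
  have k0 : (0 <= k)%R by rewrite -hxk.
  under [RHS]eq_integral do rewrite EFinM -muleA.
  rewrite integralZl_indic_nnsfun// integral_indic//= ge0_integralZl//.
  - congr (_ * _); rewrite /density_measure setIC integral_mkcondr.
    by apply: eq_integral => y _; rewrite /= patchE indicE;
      case: (y \in _); rewrite ?mul1e ?mul0e.
  - apply: emeasurable_funM => //; exact/measurable_EFinP.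
  - by move=> y _; rewrite mule_ge0// lee_fin.
under [RHS]eq_integral.
  move=> x _; rewrite fimfunE -fsumEFin// ge0_mule_fsuml; last first.
    by move=> k; rewrite nnfun_muleindic_ge0.
  over.
rewrite ge0_integral_fsum//.
- move=> k; apply: emeasurable_funM => //.
  exact/measurable_EFinP/measurable_funM.
- by move=> k x _; rewrite mule_ge0 ?lee_fin// -lee_fin nnfun_muleindic_ge0.
Qed.

Lemma ge0_integral_density : exists nu : {measure set T -> \bar R},
  (forall A, nu A = \int[mu]_(x in A) (w x)%:E) /\
  forall (D : set T) (f : T -> \bar R),
    measurable D -> measurable_fun D f -> (forall x, D x -> 0 <= f x) ->
    \int[nu]_(x in D) f x = \int[mu]_(x in D) (f x * (w x)%:E).
Proof.
by exists density_measure; split => // D f; exact: ge0_integral_density_measure.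
Qed.

End density_measure.

Section substitution.
Context (R : realType).
Notation mu := (@lebesgue_measure R).
Implicit Types (a w : R -> R) (s t : R).

Lemma within_continuous_measurable_oo w s t :
  {within `[s, t], continuous w} -> measurable_fun `]s, t[ w.
Proof.
move=> cw.
apply: measurable_funS (subspace_continuous_measurable_fun _ cw) => //.
exact: subset_itv_oo_cc.
Qed.

Lemma integral_derivative a w s t : s <= t ->
  {within `[s, t], continuous w} ->
  {within `[s, t], continuous a} ->
  (forall x : R, x \in `]s, t[ -> is_derive x 1 a (w x)) ->
  (\int[mu]_(x in `]s, t[) (w x)%:E)%E = (a t - a s)%:E :> \bar R.
Proof.
rewrite le_eqVlt => /predU1P[-> _ _ _|st cw ca da].
  by rewrite set_itvoo0 integral_set0 subrr.
rewrite -(@integral_itv_bndoo _ _ _ _ true false); last first.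
  by apply/measurable_EFinP; exact: within_continuous_measurable_oo.
rewrite (@continuous_FTC2 _ _ a _ _ st cw) ?EFinB//.
- have [_ ? ?] := (continuous_within_itvP _ st).1 ca.
  by split=> // x /da[].
- by move=> x /da; rewrite derive1E => -[].
Qed.

Lemma is_derive_gt0_homo_lt a w s t :
  {within `[s, t], continuous a} ->
  {in `]s, t[, forall x, 0 < w x} ->
  (forall x : R, x \in `]s, t[ -> is_derive x 1 a (w x)) ->
  {in `[s, t] &, {homo a : x y / x < y}}.
Proof.
move=> ca w0 da; apply: gtr0_derive1_lt_cc ca => x xst.
  by have [] := da _ xst.
have dax := da _ xst; rewrite derive1E (@derive_val _ _ _ _ _ _ _ dax).
exact: w0.
Qed.

(* The substitution lemmas of the library need a continuous integrand.  Here the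
   image under a of the measure of density w is compared with the Lebesgue measure
   on half-lines, after a has been made constant outside [s, t]. *)
Lemma ge0_integration_by_substitution_increasing a w s t (G : R -> \bar R) :
  s <= t ->
  {within `[s, t], continuous w} ->
  {in `]s, t[, forall x, 0 < w x} ->
  {within `[s, t], continuous a} ->
  (forall x : R, x \in `]s, t[ -> is_derive x 1 a (w x)) ->
  measurable_fun `]a s, a t[ G ->
  (forall y, (0 <= G y)%E) ->
  (\int[mu]_(y in `]a s, a t[) G y =
   \int[mu]_(x in `]s, t[) (G (a x) * (w x)%:E))%E.
Proof.
rewrite le_eqVlt => /predU1P[-> *|st cw w0 ca da mG G0].
  by rewrite !set_itvoo0 !integral_set0.
have incr := is_derive_gt0_homo_lt ca w0 da.
have nd : {in `[s, t] &, {homo a : x y / x <= y}}.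
  by move=> x y xst yst; rewrite le_eqVlt => /predU1P[->//|/incr /ltW]; exact.
have clampP x : Num.max s (Num.min x t) \in `[s, t].
  by rewrite in_itv/= le_max lexx/= ge_max (ltW st)/= ge_min lexx orbT.
(* Clamping makes [a'] nondecreasing, hence measurable, on the whole line, as the pushforward
   requires. *)
pose a' x := a (Num.max s (Num.min x t)).
have clampE x : x \in `]s, t[ -> Num.max s (Num.min x t) = x.
  by rewrite in_itv/= => /andP[sx xt]; rewrite min_l ?ltW// max_r ?ltW.
have a'E x : x \in `]s, t[ -> a' x = a x by move=> xst; rewrite /a' clampE.
have ma' : measurable_fun [set: R] a'.
  apply: nondecreasing_measurable => // x y xy; apply: nd => //.
  by rewrite ge_max !le_max lexx/= le_min !ge_min xy lexx !orbT.
(* Outside []s, t[] the map [a'] is constant, and any mass left there would be pushed to the points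
   [a s] and [a t]; the cut-off of [w] removes it. *)
pose w' := w \_ `]s, t[.
have w'0 x : 0 <= w' x.
  by rewrite /w' patchE; case: ifPn => // /[!inE] /w0/ltW.
have mw' : measurable_fun [set: R] w'.
  apply/(measurable_restrictT _ _).1 => //.
  exact: within_continuous_measurable_oo.
have [nu [nuE int_nu]] := ge0_integral_density mu w'0 mw'.
have nu_itv (A : set R) : measurable A ->
    nu A = (\int[mu]_(x in A `&` `]s, t[) (w x)%:E)%E.
  move=> mA; rewrite nuE integral_mkcondr; apply: eq_integral => x _.
  by rewrite /w' !patchE; case: ifPn.
(* The half-line beyond [x] corresponds to the part of []s, t[] beyond [c], where [c] is [s] if
   [x < a s], [t] if [a t <= x], and otherwise a solution of [a c = x]. *)
have sub_pre x : exists2 c, c \in `[s, t] &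
    (a' @^-1` `]x, +oo[ `&` `]s, t[ = `]c, t[%classic) /\
    (`]x, +oo[ `&` `]a s, a t[ = `]a c, a t[%classic).
  have [xas|asx] := ltP x (a s).
    exists s; first by rewrite in_itv/= lexx ltW.
    split.
      apply/seteqP; split=> [y [//]|y yst]; split => //.
      rewrite /= in_itv/= andbT a'E//; apply: (lt_trans xas).
      move: yst; rewrite /= in_itv => /andP[sy yt].
      by apply: incr; rewrite ?in_itv/= ?lexx ?(ltW st) ?(ltW sy) ?(ltW yt).
    apply/seteqP; split=> [y [//]|y yst]; split => //=.
    by move: yst; rewrite /= !in_itv/= andbT => /andP[/(lt_trans xas)].
  have [atx|xat] := leP (a t) x.
    exists t; first by rewrite in_itv/= lexx ltW.
    rewrite !set_itvoo0; split; apply/seteqP; split=> // y [] /=.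
      rewrite !in_itv/= andbT => + yst; rewrite a'E// => xay.
      move: yst => /andP[sy yt].
      have : a y < a t.
        by apply: incr; rewrite ?in_itv/= ?lexx ?(ltW st) ?(ltW sy) ?(ltW yt).
      by move=> /lt_trans/(_ (le_lt_trans atx xay)); rewrite ltxx.
    rewrite !in_itv/= andbT => xy /andP[_ yat].
    by have := lt_le_trans yat atx; rewrite ltNge (ltW xy).
  have [|c cst ac] := IVT (ltW st) ca (v := x).
    by rewrite ge_min asx/= le_max (ltW xat) orbT.
  exists c => //; rewrite -ac; move: cst; rewrite in_itv/= => /andP[sc ct]; split.
    apply/seteqP; split=> y /=.
      rewrite !in_itv/= andbT => -[+ yst]; rewrite a'E//.
      move: yst => /andP[sy yt] acy.
      rewrite yt andbT ltNge; apply: contraTN acy => yc; rewrite -leNgt.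
      by apply: nd; rewrite // in_itv/= ?sc ?ct ?(ltW sy) ?(ltW yt).
    rewrite !in_itv/= => /andP[cy yt]; have sy := le_lt_trans sc cy.
    split; last by rewrite sy yt.
    rewrite a'E ?in_itv/= ?sy// andbT.
    by apply: incr; rewrite // in_itv/= ?sc ?ct ?(ltW sy) ?(ltW yt).
  apply/seteqP; split=> y /=; rewrite !in_itv/= andbT.
    by move=> [-> /andP[]].
  by move=> /andP[cy ->]; rewrite cy (le_lt_trans _ cy)// ac.
have P_exists : exists P : {measure set (measurableTypeR R) -> \bar R},
    (forall A, P A = nu (a' @^-1` A)) /\
    (\int[P]_(y in `]a s, a t[) G y =
     \int[nu]_(x in a' @^-1` `]a s, a t[) G (a' x))%E.
  exists (pushforward nu (a' : measurableTypeR R -> measurableTypeR R)).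
  split; first by move=> A; reflexivity.
  have mD := measurable_itv `]a s, a t[.
  have G0D : {in `]a s, a t[%classic, forall y, (0 <= G y)%E}.
    by move=> y _; exact: G0.
  exact: (@ge0_integral_pushforward _ _ (measurableTypeR R) (measurableTypeR R)
    _ _ ma' nu _ _ mD mG G0D).
have [P [PE int_P]] := P_exists.
(* The common value is [a t - a c]: on the left by the fundamental theorem of calculus, on the right
   as the length of []a c, a t[]. *)
have P_itv (x : R) : exists r,
    P `]x, +oo[%classic = r%:E /\ mu (`]x, +oo[ `&` `]a s, a t[) = r%:E.
  have [c cst [preE itvE]] := sub_pre x; exists (a t - a c); rewrite itvE; split.
    rewrite PE nu_itv; last by rewrite -[X in measurable X]setTI; exact: ma'.
    rewrite preE; move: cst; rewrite in_itv/= => /andP[sc ct].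
    have intE : (\int[mu]_(x in `]c, t[) (w x)%:E)%E = (a t - a c)%:E :> \bar R.
      apply (@integral_derivative a w c t ct).
    - by apply: continuous_subspaceW cw; apply: subset_itvr; rewrite bnd_simp.
    - by apply: continuous_subspaceW ca; apply: subset_itvr; rewrite bnd_simp.
    - move=> y; rewrite in_itv/= => /andP[cy yt]; apply: da.
      by rewrite in_itv/= yt (le_lt_trans sc).
    by rewrite -intE; congr integral.
  rewrite lebesgue_measure_itv/= lte_fin; case: ltP => [|atc].
    by rewrite EFinB.
  suff -> : a t = a c by rewrite subrr.
  move: (cst); rewrite in_itv/= => /andP[_ ct].
  apply/eqP; rewrite eq_le atc/=; apply: nd => //.
  by rewrite in_itv/= (ltW st) lexx.
(* Open half-lines are stable under intersection and generate the Borel sets, and those starting at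
   [- k] cover the line with finite mass, so agreement on half-lines suffices. *)
have PmuE A : measurable A -> P A = mu (A `&` `]a s, a t[).
  pose Q : {measure set (measurableTypeR R) -> \bar R} :=
    mrestr mu (measurable_itv `]a s, a t[).
  rewrite -[X in _ = X]/(Q A).
  apply (@measure_unique _ R (measurableTypeR R) (@RGenOInfty.G R)
    (fun k => `]- k%:R, +oo[%classic)).
  - exact: RGenOInfty.measurableE.
  - move=> _ _ [x ->] [y ->]; exists (Num.max x y); apply/seteqP; split=> z /=.
      by rewrite !in_itv/= !andbT gt_max => -[-> ->].
    by rewrite !in_itv/= !andbT gt_max => /andP[].
  - by move=> k; exists (- k%:R).
  - apply/seteqP; split=> // x _; exists (Num.truncn `|x|).+1 => //=.
    rewrite in_itv/= andbT ltrNl (le_lt_trans _ (truncnS_gt _))//.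
    by rewrite -normrN ler_norm.
  - by move=> _ [x ->]; have [r [-> rE]] := P_itv x; rewrite /Q/= /mrestr rE.
  - by move=> k; have [r [-> _]] := P_itv (- k%:R); rewrite ltry.
have preD : a' @^-1` `]a s, a t[ = `]s, t[%classic.
  apply/seteqP; split=> x /=; last first.
    move=> xst; rewrite in_itv/= a'E//; move: xst; rewrite in_itv/= => /andP[sx xt].
    by rewrite !incr// in_itv/= ?lexx ?(ltW st) ?(ltW sx) ?(ltW xt).
  rewrite !in_itv/= /a' => /andP[asx axt]; apply/andP; split.
    rewrite ltNge; apply: contraTN asx => xs; rewrite -leNgt max_l//.
    by rewrite ge_min xs.
  rewrite ltNge; apply: contraTN axt => tx; rewrite -leNgt min_r// max_r// ltW//.
rewrite (eq_measure_integral P); last first.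
  by move=> A mA As; rewrite PmuE// setIidl.
rewrite int_P preD int_nu//; last first.
  have Gsub : [set a' x | x in `]s, t[] `<=` `]a s, a t[.
    move=> y [x xst <-]; have : (a' @^-1` `]a s, a t[) x by rewrite preD.
    by [].
  refine (measurable_comp (measurable_itv `]a s, a t[) Gsub mG _).
  exact: measurable_funTS ma'.
apply: eq_integral => x /[!inE] xst.
by rewrite a'E// /w' patchE mem_set.
Unshelve. exact: ma'.
Qed.

End substitution.

(** * Null sets, translations and reflections under substitution *)

Section substitution_consequences.
Context (R : realType).
Notation mu := (@lebesgue_measure R).
Implicit Types (a w : R -> R) (s t : R).

Lemma is_derive_gt0_itv a w s t x :
  {within `[s, t], continuous a} ->
  {in `]s, t[, forall x, 0 < w x} ->
  (forall x : R, x \in `]s, t[ -> is_derive x 1 a (w x)) ->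
  s < x < t -> a s < a x < a t.
Proof.
move=> ca w0 da /andP[sx xt]; have incr := is_derive_gt0_homo_lt ca w0 da.
by rewrite !incr// in_itv/= ?lexx ?(ltW sx) ?(ltW xt) ?(ltW (lt_trans sx xt)).
Qed.

Lemma measurable_comp_increasing d (T : measurableType d) a w s t (G : R -> T) :
  {within `[s, t], continuous a} ->
  {in `]s, t[, forall x, 0 < w x} ->
  (forall x : R, x \in `]s, t[ -> is_derive x 1 a (w x)) ->
  measurable_fun `]a s, a t[ G -> measurable_fun `]s, t[ (G \o a).
Proof.
move=> ca w0 da mG.
have Gsub : [set a x | x in `]s, t[] `<=` `]a s, a t[.
  move=> _ [x + <-]; rewrite /= !in_itv/=; exact: is_derive_gt0_itv ca w0 da.
refine (measurable_comp (measurable_itv `]a s, a t[) Gsub mG _).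
exact: within_continuous_measurable_oo.
Qed.

(** Substitution in the indicator function of a null set [N] shows that [1_N (a x) * w x] has
    integral zero; since [w > 0], almost every [x] has [a x] outside [N]. *)
Lemma ae_comp_increasing a w s t (P : R -> Prop) : s <= t ->
  {within `[s, t], continuous w} ->
  {in `]s, t[, forall x, 0 < w x} ->
  {within `[s, t], continuous a} ->
  (forall x : R, x \in `]s, t[ -> is_derive x 1 a (w x)) ->
  {ae mu, forall y, a s < y < a t -> P y} ->
  {ae mu, forall x, s < x < t -> P (a x)}.
Proof.
move=> st cw w0 ca da [N [mN N0 PN]].
pose G (y : R) : \bar R := (\1_N y)%:E.
have mG : measurable_fun `]a s, a t[ G.
  by apply/measurable_EFinP; apply: measurable_funTS; exact: measurable_indic.
have G0 y : (0 <= G y)%E by rewrite lee_fin.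
have := ge0_integration_by_substitution_increasing st cw w0 ca da mG G0.
have -> : (\int[mu]_(y in `]a s, a t[) G y = 0)%E.
  rewrite integral_indic; [|exact: measurable_itvR|exact: mN].
  apply/eqP; rewrite -measure_le0 -N0; apply: le_measure; [| |exact: subIsetl].
    by rewrite inE; apply: measurableI => //; exact: measurable_itvR.
  by rewrite inE.
have mGa : measurable_fun `]s, t[ (fun x => G (a x) * (w x)%:E)%E.
  apply: emeasurable_funM.
    exact: (@measurable_comp_increasing _ _ a w s t G ca w0 da mG).
  by apply/measurable_EFinP; exact: within_continuous_measurable_oo.
have Gaw0 x : x \in `]s, t[ -> (0 <= G (a x) * (w x)%:E)%E.
  by move=> xst; rewrite mule_ge0// lee_fin ltW// w0.
move=> /esym int0.
have /(ae_eq_integral_abs mu (measurable_itvR `]s, t[) mGa) :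
    (\int[mu]_(x in `]s, t[) `|G (a x) * (w x)%:E| = 0)%E.
  rewrite -[RHS]int0; apply: eq_integral => x /[!inE] xst.
  by rewrite gee0_abs ?Gaw0.
move=> [N' [mN' N'0 sub]]; exists N'; split => // x nx; apply: sub => H.
apply: nx => xst; move: H; have xst' : x \in `]s, t[ by rewrite in_itv.
move=> /(_ xst')/eqP; rewrite /G -EFinM eqe mulf_eq0.
rewrite (gt_eqF (w0 _ xst')) orbF indicE.
rewrite pnatr_eq0 eqb0 => /negP axN; apply: contrapT => nP; apply: axN.
apply/mem_set; apply: PN => /= /(_ (is_derive_gt0_itv ca w0 da xst)).
exact: nP.
Qed.

Lemma ge0_integral_shift (G : R -> \bar R) t s : 0 <= s ->
  measurable_fun `]t, t + s[ G -> (forall y, (0 <= G y)%E) ->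
  (\int[mu]_(x in `]0%R, s[) G (t + x)%R = \int[mu]_(y in `]t, (t + s)%R[) G y)%E.
Proof.
move=> s0 mG G0.
pose a x := t + x.
have ca : continuous a.
  by move=> x; apply: cvgD; [exact: cvg_cst|exact: cvg_id].
have da (x : R) : x \in `]0, s[ -> is_derive x 1 a (cst 1 x).
  move=> _; have : is_derive x 1 (cst t + @id R) (0 + 1) by exact: is_deriveD.
  by rewrite add0r.
have c1 : {within `[0, s], continuous (cst 1 : R -> R)}.
  by apply: continuous_subspaceT => x; exact: cst_continuous.
have p1 : {in `]0, s[, forall x, 0 < cst (1 : R) x} by [].
have mG' : measurable_fun `]a 0, a s[ G by rewrite /a addr0.
have -> : `]t, t + s[%classic = `]a 0, a s[%classic by rewrite /a addr0.
rewrite (ge0_integration_by_substitution_increasing s0 c1 p1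
  (continuous_subspaceT ca) da mG' G0).
by apply: eq_integral => x _; rewrite mule1.
Qed.

(** The map [x |-> t - x] is decreasing, so it is split into a translation and the symmetry [-%R],
    which preserves Lebesgue measure. *)
Lemma ge0_integral_reflection (G : R -> \bar R) t s : 0 <= s ->
  measurable_fun `]t - s, t[ G -> (forall y, (0 <= G y)%E) ->
  (\int[mu]_(x in `]0%R, s[) G (t - x)%R = \int[mu]_(y in `](t - s)%R, t[) G y)%E.
Proof.
move=> s0 mG G0.
have preE :
    (-%R : _ -> measurableTypeR R) @^-1` `]t - s, t[ = `]- t, - t + s[%classic.
  by rewrite opp_preimage_itvbndbnd/= opprB addrC.
transitivity (\int[mu]_(x in `]0%R, s[) (G \o -%R) (- t + x)%R)%E.
  by apply: eq_integral => x _ /=; rewrite opprD opprK.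
have mGN : measurable_fun `]- t, - t + s[ (G \o -%R).
  rewrite -preE.
  refine (measurable_comp (measurable_itv `]t - s, t[) _ mG _).
    by move=> _ [x + <-].
  by apply: measurable_funTS; exact: oppr_measurable.
rewrite (ge0_integral_shift s0 mGN (fun y => G0 (- y))).
rewrite -preE -ge0_integral_pushforward//=.
by apply: eq_measure_integral => //= A mA AS; exact/lebesgue_measureN.
Qed.

End substitution_consequences.

(** * The characteristics through the moving end *)

Lemma within_continuous_comp_within (T U V : topologicalType) (A : set T)
    (B : set U) (g : T -> U) (f : U -> V) :
  (forall x, A x -> B (g x)) ->
  {within A, continuous g} -> {within B, continuous f} ->
  {within A, continuous (f \o g)}.
Proof.
move=> gAB /subspace_continuousP cg /subspace_continuousP cf.
apply/subspace_continuousP => x Ax W /(cf _ (gAB _ Ax)) fW.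
have := cg x Ax _ fW; rewrite /nbhs/= /within/=.
by apply: filterS => y gyW Ay; exact: gyW Ay (gAB _ Ay).
Qed.

Section characteristics.
Context (R : realType).
Variables (l dl phi dphi : R -> R).
Hypotheses (l_cont : {within `[0, +oo[, continuous l})
  (l_gt0 : forall t : R, 0 <= t -> 0 < l t)
  (l_deriv : forall t : R, 0 <= t -> is_derive_within `[0, +oo[ l t (dl t))
  (dl_lt1 : forall t : R, 0 <= t -> `|dl t| < 1)
  (phi_deriv : forall x : R, - l 0 <= x ->
     is_derive_within `[- l 0, +oo[ phi x (dphi x))
  (dphi_cont : {within `[- l 0, +oo[, continuous dphi})
  (dphi_gt0 : forall x : R, - l 0 <= x -> 0 < dphi x)
  (phi_eq : forall t : R, 0 <= t -> phi (t + l t) - phi (t - l t) = 2).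

Let nbhs_itvcy (c x : R) : c < x -> nbhs x `[c, +oo[%classic.
Proof.
move=> cx; have : nbhs x `]c, +oo[%classic.
  by apply: open_nbhs_nbhs; split; [exact: interval_open|rewrite /= in_itv/= cx].
by apply: filterS => y /=; rewrite !in_itv/= !andbT; exact: ltW.
Qed.

Let is_derive_l (t : R) : 0 < t -> is_derive t 1 l (dl t).
Proof.
by move=> t0; exact: is_derive_within_interior (nbhs_itvcy t0) (l_deriv (ltW t0)).
Qed.

Lemma is_derive_addl (t : R) : 0 < t -> is_derive t 1 (fun x => x + l x) (1 + dl t).
Proof. by move=> t0; apply: is_deriveD; exact: is_derive_l. Qed.

Lemma is_derive_subl (t : R) : 0 < t -> is_derive t 1 (fun x => x - l x) (1 - dl t).
Proof. by move=> t0; apply: is_deriveB; exact: is_derive_l. Qed.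

Lemma continuous_addl : {within `[0, +oo[, continuous (fun x => x + l x)}.
Proof.
apply: (within_continuousD (f := @id R)) => //.
by apply: continuous_subspaceT => x; exact: cvg_id.
Qed.

Lemma continuous_subl : {within `[0, +oo[, continuous (fun x => x - l x)}.
Proof.
apply: (within_continuousB (f := @id R)) => //.
by apply: continuous_subspaceT => x; exact: cvg_id.
Qed.

Let dl_itv t : 0 <= t -> - 1 < dl t < 1.
Proof. by move=> /dl_lt1; rewrite ltr_norml. Qed.

Let sub_itvcy (s t : R) : 0 <= s -> `[s, t] `<=` `[0, +oo[.
Proof.
by move=> s0 x /=; rewrite !in_itv/= => /andP[sx _]; rewrite (le_trans s0).
Qed.

Lemma subl_lt s t : 0 <= s -> s < t -> s - l s < t - l t.
Proof.
move=> s0 st.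
have := @is_derive_gt0_homo_lt R (fun x => x - l x) (fun x => 1 - dl x) s t.
apply => //.
- by apply: continuous_subspaceW continuous_subl; exact: sub_itvcy.
- move=> x; rewrite in_itv/= => /andP[sx _].
  by rewrite subr_gt0; have /andP[] := dl_itv (le_trans s0 (ltW sx)).
- move=> x; rewrite in_itv/= => /andP[sx _].
  exact: is_derive_subl (le_lt_trans s0 sx).
- by rewrite in_itv/= lexx ltW.
- by rewrite in_itv/= lexx ltW.
Qed.

Lemma addl_lt s t : 0 <= s -> s < t -> s + l s < t + l t.
Proof.
move=> s0 st.
have := @is_derive_gt0_homo_lt R (fun x => x + l x) (fun x => 1 + dl x) s t.
apply => //.
- by apply: continuous_subspaceW continuous_addl; exact: sub_itvcy.
- move=> x; rewrite in_itv/= => /andP[sx _].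
  by rewrite -ltrBlDl sub0r; have /andP[] := dl_itv (le_trans s0 (ltW sx)).
- move=> x; rewrite in_itv/= => /andP[sx _].
  exact: is_derive_addl (le_lt_trans s0 sx).
- by rewrite in_itv/= lexx ltW.
- by rewrite in_itv/= lexx ltW.
Qed.

Lemma subl_ge t : 0 <= t -> - l 0 <= t - l t.
Proof.
rewrite le_eqVlt => /predU1P[<-|/(subl_lt (lexx 0))/ltW]; first by rewrite sub0r.
by rewrite sub0r.
Qed.

Let addl_ge t : 0 <= t -> - l 0 <= t + l t.
Proof.
move=> t0; rewrite (@le_trans _ _ 0)//; first by rewrite oppr_le0 ltW// l_gt0.
by rewrite addr_ge0// ltW// l_gt0.
Qed.

(** This differentiates the constant [phi (t + l t) - phi (t - l t)]. For [t > 0] both arguments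
    exceed [- l 0], so the derivatives of [phi] there are two-sided and the chain rule applies. *)
Lemma dphi_speed t : 0 < t ->
  dphi (t + l t) * (1 + dl t) = dphi (t - l t) * (1 - dl t).
Proof.
move=> t0; have t0' := ltW t0.
have dphi_at x : - l 0 < x -> is_derive x 1 phi (dphi x).
  move=> lx.
  exact: is_derive_within_interior (nbhs_itvcy lx) (phi_deriv (ltW lx)).
have da : is_derive t 1 (phi \o (fun x => x + l x)) (dphi (t + l t) * (1 + dl t)).
  apply: is_derive1_comp (is_derive_addl t0).
  apply: dphi_at; rewrite (@le_lt_trans _ _ 0)//.
    by rewrite oppr_le0 ltW// l_gt0.
  by rewrite addr_gt0// l_gt0.
have db : is_derive t 1 (phi \o (fun x => x - l x)) (dphi (t - l t) * (1 - dl t)).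
  apply: is_derive1_comp (is_derive_subl t0).
  by apply: dphi_at; rewrite -sub0r; exact: subl_lt.
have d0 : is_derive t 1 ((phi \o (fun x => x + l x)) - (phi \o (fun x => x - l x))) 0.
  apply: (@near_eq_is_derive R R^o R^o (fun=> 2%:R)).
  by apply: filterS (nbhs_itvcy t0) => x /=; rewrite in_itv/= andbT => /phi_eq.
have d1 := is_deriveB da db.
apply/eqP; rewrite -subr_eq0; apply/eqP.
by rewrite -(@derive_val _ _ _ _ _ _ _ d1) (@derive_val _ _ _ _ _ _ _ d0).
Qed.

(* Differentiating phi (t + l t) - phi (t - l t) = 2 gives the ratio of 1 + l' and
   1 - l', so l is C^1 on ]0, +oo[ although it is only assumed differentiable; da
   and db are the continuous extensions of 1 + l' and 1 - l' to [0, +oo[. *)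
Lemma characteristic_speeds : exists da db : R -> R,
  [/\ {within `[0, +oo[, continuous da} /\ {within `[0, +oo[, continuous db},
      forall t : R, 0 <= t -> 0 < da t /\ 0 < db t
    & forall t : R, 0 < t -> da t = 1 + dl t /\ db t = 1 - dl t].
Proof.
have da0 t : 0 <= t -> 0 < dphi (t + l t) by move=> t0; exact/dphi_gt0/addl_ge.
have db0 t : 0 <= t -> 0 < dphi (t - l t) by move=> t0; exact/dphi_gt0/subl_ge.
have s0 t : 0 <= t -> 0 < dphi (t + l t) + dphi (t - l t).
  by move=> t0; rewrite addr_gt0 ?da0 ?db0.
have cpa : {within `[0, +oo[, continuous (fun t => dphi (t + l t))}.
  apply: (within_continuous_comp_within (B := `[- l 0, +oo[) _
    continuous_addl dphi_cont).
  by move=> t /=; rewrite !in_itv/= !andbT; exact: addl_ge.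
have cpb : {within `[0, +oo[, continuous (fun t => dphi (t - l t))}.
  apply: (within_continuous_comp_within (B := `[- l 0, +oo[) _
    continuous_subl dphi_cont).
  by move=> t /=; rewrite !in_itv/= !andbT; exact: subl_ge.
have cq (p : R -> R) : {within `[0, +oo[, continuous p} ->
    {within `[0, +oo[, continuous
      (fun t => 2 * p t / (dphi (t + l t) + dphi (t - l t)))}.
  move=> /subspace_continuousP cp; move/subspace_continuousP : cpa => cpa'.
  move/subspace_continuousP : cpb => cpb'; apply/subspace_continuousP => t t0.
  apply: cvgM; first by apply: cvgM; [exact: cvg_cst|exact: cp].
  apply: cvgV; last by apply: cvgD; [exact: cpa'|exact: cpb'].
  by rewrite gt_eqF// s0//; move: t0; rewrite /= in_itv/= andbT.
(* The solution of [dphi (t + l t) * da t = dphi (t - l t) * db t] and [da t + db t = 2]. *)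
pose da t := 2 * dphi (t - l t) / (dphi (t + l t) + dphi (t - l t)).
pose db t := 2 * dphi (t + l t) / (dphi (t + l t) + dphi (t - l t)).
exists da, db; split.
- by split; exact: cq.
- by move=> t t0; rewrite !divr_gt0 ?mulr_gt0 ?da0 ?db0 ?s0.
- move=> t t0; have t0' := ltW t0; have := dphi_speed t0.
  have := gt_eqF (s0 _ t0'); rewrite /da /db => sn E.
  split; apply: (mulIf (negbT sn)); rewrite divfK ?sn//; lra.
Qed.

End characteristics.

(** * The energy on the characteristics *)

Section energy_monotonicity.
Context (R : realType).
Notation mu := (@lebesgue_measure R).
Implicit Types (h : R -> R).

Lemma ge0_integral_oo_split (F : R -> \bar R) (c d e : R) : c <= d -> d <= e ->
  measurable_fun `]c, e[ F -> (forall x, (0 <= F x)%E) ->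
  (\int[mu]_(x in `]c, e[) F x =
   \int[mu]_(x in `]c, d[) F x + \int[mu]_(x in `]d, e[) F x)%E.
Proof.
move=> cd de mF F0; have [->|ned] := eqVneq d e.
  by rewrite set_itvoo0 integral_set0 adde0.
have {ned}de' : d < e by rewrite lt_neqAle ned.
have [<-|ncd] := eqVneq c d.
  by rewrite set_itvoo0 integral_set0 add0e.
have {ncd}cd' : c < d by rewrite lt_neqAle ncd.
have sub : `]d, e[ `<=` `]c, e[ by apply: subset_itvr; rewrite bnd_simp.
have mFr := measurable_funS (measurable_itv _) sub mF.
rewrite (integral_itv_obnd_cbnd mFr).
rewrite -ge0_integral_setU//=.
- congr integral; apply/seteqP; split=> x /=; rewrite !in_itv/=.
    by move=> /andP[cx xe]; case: (ltP x d) => xd; [left|right]; rewrite ?cx ?xe.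
  case=> /andP[x1 x2]; first by rewrite x1 (lt_trans x2).
  by rewrite x2 (lt_le_trans cd').
- apply: measurable_funS (measurable_itv _) _ mF => x /= [].
    by rewrite !in_itv/= => /andP[-> /lt_trans]; apply.
  by rewrite !in_itv/= => /andP[dx ->]; rewrite (lt_le_trans cd').
- apply/disj_setPS => x [] /=; rewrite !in_itv/= => /andP[_ xd] /andP[dx _].
  by have := lt_le_trans xd dx; rewrite ltxx.
Qed.

(** The two characteristics enter symmetrically, up to the order of their speeds, so that exchanging
    them serves the other sign of [l']. *)
Lemma ge0_integral_flux_le h (a b da db : R -> R) (s t : R) : s <= t ->
  {within `[s, t], continuous da} -> {within `[s, t], continuous db} ->
  {in `]s, t[, forall x, 0 < da x} -> {in `]s, t[, forall x, 0 < db x} ->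
  {within `[s, t], continuous a} -> {within `[s, t], continuous b} ->
  (forall x : R, x \in `]s, t[ -> is_derive x 1 a (da x)) ->
  (forall x : R, x \in `]s, t[ -> is_derive x 1 b (db x)) ->
  measurable_fun `]a s, a t[ h -> measurable_fun `]b s, b t[ h ->
  {ae mu, forall x, s < x < t -> da x * h (a x) = - (db x * h (b x))} ->
  {in `]s, t[, forall x, da x <= db x} ->
  (\int[mu]_(y in `]b s, b t[) (h y ^+ 2)%:E <=
   \int[mu]_(y in `]a s, a t[) (h y ^+ 2)%:E)%E.
Proof.
move=> st cda cdb da0 db0 ca cb ada bdb mha mhb [N [mN N0 flux]] dab.
pose F (y : R) : \bar R := (h y ^+ 2)%:E.
have F0 y : (0 <= F y)%E by rewrite lee_fin sqr_ge0.
have mF (i : interval R) : measurable_fun [set` i] h -> measurable_fun [set` i] F.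
  by move=> mh; apply/measurable_EFinP; exact: measurable_funX.
have mFa := mF _ mha; have mFb := mF _ mhb.
rewrite (ge0_integration_by_substitution_increasing st cda da0 ca ada mFa F0).
rewrite (ge0_integration_by_substitution_increasing st cdb db0 cb bdb mFb F0).
apply: ae_ge0_le_integral.
- exact: measurable_itvR.
- by move=> x xst; rewrite mule_ge0// lee_fin ltW// db0.
- apply: emeasurable_funM.
    exact: (@measurable_comp_increasing _ _ _ b db s t F cb db0 bdb mFb).
  by apply/measurable_EFinP; exact: within_continuous_measurable_oo.
- by move=> x xst; rewrite mule_ge0// lee_fin ltW// da0.
- apply: emeasurable_funM.
    exact: (@measurable_comp_increasing _ _ _ a da s t F ca da0 ada mFa).
  by apply/measurable_EFinP; exact: within_continuous_measurable_oo.
exists N; split => // x nx; apply: flux => H; apply: nx => xst.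
have xst' : s < x < t by move: xst; rewrite /= in_itv.
have {}H := H xst'; rewrite /F -!EFinM lee_fin.
have p0 := da0 x xst; have q0 := db0 x xst; have pq := dab x xst.
(* The factor [da x] turns the right-hand side into [(da x * h (a x)) ^ 2], which the flux condition
   equates with [(db x * h (b x)) ^ 2]; what remains is [da x * db x <= db x ^ 2]. *)
rewrite -(ler_pM2l p0).
have -> : da x * (h (a x) ^+ 2 * da x) = (da x * h (a x)) ^+ 2 by ring.
rewrite H sqrrN exprMn.
have := sqr_ge0 (h (b x)); move: (h (b x) ^+ 2) => z z0.
have : 0 <= z * (db x * (db x - da x)) by rewrite !mulr_ge0 ?subr_ge0 ?(ltW q0).
nra.
Qed.

(** By the parallelogram identity the density is [2 * (df ^ 2 + dg ^ 2)], and the 2 cancels the one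
    half in the energy. The [dg] term covers []t - l t, t[]; the [df] term covers []t, t + l t[],
    where [df ^ 2 = dg ^ 2] almost everywhere. *)
Lemma energy_characteristic (l : R -> R) (ut ux : R -> R -> R) df dg t :
  0 <= l t ->
  (forall x, 0 < x < l t -> ux x t = df (t + x) - dg (t - x) /\
                            ut x t = df (t + x) + dg (t - x)) ->
  measurable_fun `]t, t + l t[ df ->
  measurable_fun `]t - l t, t + l t[ dg ->
  {ae mu, forall y, t < y < t + l t -> df y + dg y = 0} ->
  energy l ut ux t =
    fine (\int[mu]_(y in `](t - l t)%R, (t + l t)%R[) (dg y ^+ 2)%:E)%E.
Proof.
move=> l0 uE mdf mdg ae0; set s := l t.
pose F (y : R) : \bar R := (df y ^+ 2)%:E.
pose G (y : R) : \bar R := (dg y ^+ 2)%:E.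
have F0 y : (0 <= F y)%E by rewrite lee_fin sqr_ge0.
have G0 y : (0 <= G y)%E by rewrite lee_fin sqr_ge0.
have mF : measurable_fun `]t, t + s[ F.
  by apply/measurable_EFinP; exact: measurable_funX.
have mG : measurable_fun `]t - s, t + s[ G.
  by apply/measurable_EFinP; exact: measurable_funX.
have mGl : measurable_fun `]t - s, t[ G.
  apply: measurable_funS (measurable_itv _) _ mG.
  by apply: subset_itvl; rewrite bnd_simp lerDl.
have mGr : measurable_fun `]t, t + s[ G.
  apply: measurable_funS (measurable_itv _) _ mG.
  by apply: subset_itvr; rewrite bnd_simp gerBl.
have sumE : (\int[mu]_(x in `]0%R, s[) (ut x t ^+ 2 + ux x t ^+ 2)%:E =
    2%:E * \int[mu]_(y in `](t - s)%R, (t + s)%R[) G y)%E.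
  transitivity (\int[mu]_(x in `]0%R, s[) (2%:E * (F (t + x)%R + G (t - x)%R)))%E.
    apply: eq_integral => x /[!inE]; rewrite /= in_itv/= => /uE[-> ->].
    by rewrite /F /G -EFinD -EFinM; congr EFin; ring.
  have mFs : measurable_fun `]0, s[ (fun x => F (t + x)).
    refine (measurable_comp (measurable_itv `]t, t + s[) _ mF _).
      by move=> _ [x + <-]; rewrite /= !in_itv/= ltrDl ltrD2l.
    by apply: measurable_funTS; exact: measurable_funD.
  have mGs : measurable_fun `]0, s[ (fun x => G (t - x)).
    refine (measurable_comp (measurable_itv `]t - s, t[) _ mGl _).
      move=> _ [x + <-]; rewrite /= !in_itv/= ltrD2l ltrN2 gtrBl.
      by move=> /andP[-> ->].
    by apply: measurable_funTS; exact: measurable_funB.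
  rewrite ge0_integralZl//; last 2 first.
  - exact: emeasurable_funD.
  - by move=> x _; rewrite adde_ge0.
  congr (_ * _)%E; rewrite ge0_integralD//.
  rewrite ge0_integral_shift// ge0_integral_reflection//.
  have tst : t - s <= t by rewrite gerBl.
  have tts : t <= t + s by rewrite lerDl.
  rewrite (ge0_integral_oo_split tst tts mG G0) addeC; congr (_ + _)%E.
  apply: ge0_ae_eq_integral => //.
  case: ae0 => N [mN N0 sub]; exists N; split => // y ny; apply: sub => H.
  apply: ny => yI; rewrite /F /G; congr EFin.
  have /eqP : df y + dg y = 0 by apply: H; move: yI; rewrite /= in_itv.
  by rewrite addr_eq0 => /eqP ->; rewrite sqrrN.
rewrite /energy /Rintegral sumE.
(* If the integral is infinite, both sides are 0 because fine is 0 there. *)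
have [Gfin|] := boolP (\int[mu]_(y in `](t - s)%R, (t + s)%R[) G y \is a fin_num)%E.
  by rewrite fineM// mulrA mulVf ?mul1r.
rewrite fin_numE negb_and !negbK => /orP[|] /eqP ->.
  by rewrite mulrNy gtr0_sg// mul1e/= mulr0.
by rewrite mulry gtr0_sg// mul1e/= mulr0.
Qed.

End energy_monotonicity.

(** * Energy balance between two times and its sign *)

Theorem mainTheorem6 (R : realType)
  (l dl : R -> R)
  (l_cont : {within `[0, +oo[, continuous l})
  (l_gt0 : forall t, 0 <= t -> 0 < l t)
  (l_deriv : forall t, 0 <= t -> is_derive_within `[0, +oo[ l t (dl t))
  (dl_lt1 : forall t, 0 <= t -> `|dl t| < 1)
  (phi dphi : R -> R)
  (phi_deriv : forall x, - l 0 <= x ->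
     is_derive_within `[- l 0, +oo[ phi x (dphi x))
  (dphi_cont : {within `[- l 0, +oo[, continuous dphi})
  (dphi_gt0 : forall x, - l 0 <= x -> 0 < dphi x)
  (phi_eq : forall t, 0 <= t -> phi (t + l t) - phi (t - l t) = 2)
  (u0 u1 : R -> R)
  (u0_H1 : H1 0 (l 0) u0)
  (u0_0 : u0 0 = 0)
  (u1_L2 : L2 0 (l 0) u1)
  (u ut ux : R -> R -> R)
  (u_sol : wave_solution l dl u0 u1 u ut ux)
  (I : set R)
  (I_itv : is_interval I)
  (I_ge0 : I `<=` `[0, +oo[) :
  ((forall t, I t -> -1 < dl t <= 0) ->
     forall s t, I s -> I t -> s <= t ->
       energy l ut ux s <= energy l ut ux t) /\
  ((forall t, I t -> 0 <= dl t < 1) ->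
     forall s t, I s -> I t -> s <= t ->
       energy l ut ux t <= energy l ut ux s).
Proof.
case: u_sol => [[f [df [g [dg [fH gH uE]]]]] bc u00 _ _].
have L0 : 0 < l 0 by exact: l_gt0.
have NL0 : - l 0 <= 0 by rewrite oppr_le0 ltW.
(* Here [x] is a time: this is d'Alembert's formula at the fixed end. *)
have fg0 x : 0 < x -> f x + g x = 0.
  move=> x0; rewrite -(u00 _ x0); have [|-> _ _] := uE 0 x (ltW x0).
    by rewrite lexx/= ltW// l_gt0// ltW.
  by rewrite addr0 subr0.
have ae0 (r : R) : 0 < r ->
    {ae lebesgue_measure, forall x, 0 < x < r -> df x + dg x = 0}.
  move=> r0; apply: (ae_addr_eq0_weak_derivative NL0 (fH _ r0) (gH _ r0)).
  by move=> x /andP[+ _]; exact: fg0.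
have mdf (c d : R) : 0 <= c -> measurable_fun `]c, d[ df.
  (* The maximum with [1] keeps [r] positive even if [d] is not. *)
  move=> c0; pose r := Num.max d 1; have r0 : 0 < r by rewrite lt_max ltr01 orbT.
  have [_ _ /L2_measurable] := fH _ r0.
  move=> + _; apply: measurable_funS => //.
  by apply: subset_itv; rewrite bnd_simp ?le_max ?lexx.
have dg2 (r : R) : 0 < r -> L2 (- l 0) r dg by move=> /gH[].
have sub_itv (c d : R) : - l 0 <= c ->
    exists2 r : R, 0 < r & `]c, d[ `<=` `]- l 0, r[.
  move=> c0; exists (Num.max d 1); first by rewrite lt_max ltr01 orbT.
  by apply: subset_itv; rewrite bnd_simp ?le_max ?lexx.
have mdg (c d : R) : - l 0 <= c -> measurable_fun `]c, d[ dg.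
  move=> /(sub_itv c d)[r r0 sub].
  by apply: measurable_funS sub (L2_measurable (dg2 r r0)).
have subl_ge0 := subl_ge l_cont l_deriv dl_lt1.
have addl_ge0 (t : R) : 0 <= t -> 0 <= t + l t.
  by move=> t0; rewrite addr_ge0// ltW// l_gt0.
pose J (c d : R) := (\int[lebesgue_measure]_(y in `]c, d[) (dg y ^+ 2)%:E)%E.
have Jfin (c d : R) : - l 0 <= c -> J c d \is a fin_num.
  move=> /(sub_itv c d)[r r0 sub].
  have i2 := L2_integrable_sqr (dg2 r r0).
  have := integrableS (measurable_itvR _) (measurable_itvR _) sub i2.
  by move=> /integrable_fin_num; apply.
have Jsplit (c d e : R) : - l 0 <= c -> c <= d -> d <= e ->
    J c e = (J c d + J d e)%E.
  move=> lc cd de; apply: ge0_integral_oo_split => //.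
    by apply/measurable_EFinP; apply: measurable_funX; exact: mdg.
  by move=> x; rewrite lee_fin sqr_ge0.
have energyE (t : R) : 0 <= t -> energy l ut ux t = fine (J (t - l t) (t + l t)).
  move=> t0; have lt0 := l_gt0 _ t0.
  apply: (@energy_characteristic R l ut ux df dg t (ltW lt0)).
  - move=> x /andP[x0 xl]; have [|_ -> ->//] := uE x t t0.
    by rewrite !ltW.
  - exact: mdf.
  - by apply: mdg; exact: subl_ge0.
  - have tl0 : 0 < t + l t by rewrite ltr_wpDl.
    have [N [mN N0 sub]] := ae0 _ tl0; exists N; split => // x nx.
    apply: sub => H; apply: nx => /andP[tx xl]; apply: H.
    by rewrite (le_lt_trans t0 tx).
have [da [db [[cda cdb] dab0 dabE]]] := characteristic_speeds l_cont l_gt0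
  l_deriv dl_lt1 phi_deriv dphi_cont dphi_gt0 phi_eq.
(* Both sides equal [J (s - l s) (t + l t)], split at [s + l s] on the left and at [t - l t] on the
   right, whatever the order of these two points. *)
have balance (s t : R) : 0 <= s -> s < t ->
    energy l ut ux s + fine (J (s + l s) (t + l t)) =
    fine (J (s - l s) (t - l t)) + energy l ut ux t.
  move=> s0 st; have t0 : 0 <= t by rewrite (le_trans s0)// ltW.
  have bs := subl_ge0 _ s0; have bt := subl_ge0 _ t0.
  have as0 := le_trans NL0 (addl_ge0 _ s0).
  have ab (x : R) : 0 <= x -> x - l x <= x + l x.
    by move=> x0; rewrite lerD2l ge0_cp// ltW// l_gt0.
  have := subl_lt l_cont l_deriv dl_lt1 s0 st.
  have := addl_lt l_cont l_deriv dl_lt1 s0 st.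
  move=> /ltW ast /ltW bst.
  rewrite !energyE// -!fineD ?Jfin//.
  by rewrite -!Jsplit ?ab.
have speeds (s t : R) : 0 <= s -> [/\
    {within `[s, t], continuous da}, {within `[s, t], continuous db},
    {in `]s, t[, forall x, 0 < da x} & {in `]s, t[, forall x, 0 < db x}].
  move=> s0; have sub : `[s, t] `<=` `[0, +oo[.
    by move=> x /=; rewrite !in_itv/= => /andP[sx _]; rewrite (le_trans s0).
  split; [exact: continuous_subspaceW cda|exact: continuous_subspaceW cdb| |];
    by move=> x; rewrite in_itv/= => /andP[sx _];
       case: (dab0 x (le_trans s0 (ltW sx))).
have chars (s t : R) : 0 <= s -> [/\
    {within `[s, t], continuous (fun x => x + l x)},
    {within `[s, t], continuous (fun x => x - l x)},
    (forall x : R, x \in `]s, t[ -> is_derive x 1 (fun x => x + l x) (da x)) &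
    (forall x : R, x \in `]s, t[ -> is_derive x 1 (fun x => x - l x) (db x))].
  move=> s0; have sub : `[s, t] `<=` `[0, +oo[.
    by move=> x /=; rewrite !in_itv/= => /andP[sx _]; rewrite (le_trans s0).
  split.
  - exact: continuous_subspaceW (continuous_addl l_cont).
  - exact: continuous_subspaceW (continuous_subl l_cont).
  - move=> x; rewrite in_itv/= => /andP[sx _]; have x0 := le_lt_trans s0 sx.
    by have [-> _] := dabE _ x0; exact: is_derive_addl.
  - move=> x; rewrite in_itv/= => /andP[sx _]; have x0 := le_lt_trans s0 sx.
    by have [_ ->] := dabE _ x0; exact: is_derive_subl.
have flux (s t : R) : 0 <= s -> s < t ->
    {ae lebesgue_measure, forall x, s < x < t ->
      da x * dg (x + l x) = - (db x * dg (x - l x))}.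
  move=> s0 st; have t0 : 0 < t by rewrite (le_lt_trans s0).
  have [cda' cdb' da0 db0] := speeds s t s0; have [ca cb ada adb] := chars s t s0.
  have atl0 : 0 < t + l t by rewrite addr_gt0// l_gt0// ltW.
  have ae1 : {ae lebesgue_measure, forall y,
      s + l s < y < t + l t -> df y + dg y = 0}.
    have [N [mN N0 sub]] := ae0 _ atl0; exists N; split => // x nx.
    apply: sub => H; apply: nx => /andP[tx xl]; apply: H.
    by rewrite (le_lt_trans (addl_ge0 _ s0) tx).
  have [N1 [mN1 N10 sub1]] := ae_comp_increasing (ltW st) cda' da0 ca ada ae1.
  have [N2 [mN2 N20 sub2]] := bc.
  (* [N1] contains the times at which [x + l x] meets the exceptional set of [df + dg = 0], and [N2]
     those at which the boundary condition fails. *)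
  exists (N1 `|` N2); split; first exact: measurableU.
    by apply: null_set_setU.
  move=> x nx; apply: contrapT => /not_orP[xN1 xN2]; apply: nx => /= xst.
  have x0 : 0 < x by move: xst => /andP[sx _]; rewrite (le_lt_trans s0).
  have H1 : df (x + l x) + dg (x + l x) = 0.
    by apply: contrapT => H; apply: xN1; apply: sub1 => /= /(_ xst).
  have H2 : ux (l x) x + dl x * ut (l x) x = 0.
    by apply: contrapT => H; apply: xN2; apply: sub2 => /= /(_ x0).
  move: H2; have [|_ -> ->] := uE (l x) x (ltW x0).
    by rewrite lexx ltW// l_gt0// ltW.
  have [-> ->] := dabE _ x0.
  have -> : df (x + l x) = - dg (x + l x) by apply/eqP; rewrite -addr_eq0 H1.
  by move=> H2; lra.
have Isub (s t x : R) : I s -> I t -> s < x < t -> I x.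
  move=> Is It /andP[sx xt]; apply: (I_itv s t) => //.
  by rewrite !ltW.
have I0 (s : R) : I s -> 0 <= s by move=> /I_ge0; rewrite /= in_itv/= andbT.
split=> dlI s t Is It; rewrite le_eqVlt => /predU1P[->//|st].
- have s0 := I0 _ Is; have := balance s t s0 st.
  have [cda' cdb' da0 db0] := speeds s t s0; have [ca cb ada adb] := chars s t s0.
  suff : fine (J (s - l s) (t - l t)) <= fine (J (s + l s) (t + l t)) by lra.
  apply: fine_le; [by apply: Jfin; exact: subl_ge0| |].
    by apply: Jfin; exact: le_trans (addl_ge0 _ s0).
  apply: (ge0_integral_flux_le (ltW st) cda' cdb' da0 db0 ca cb ada adb).
  + by apply: mdg; exact: le_trans (addl_ge0 _ s0).
  + by apply: mdg; exact: subl_ge0.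
  + exact: flux.
  + move=> x; rewrite in_itv/= => xst; have [sx _] := andP xst.
    have [-> ->] := dabE _ (le_lt_trans s0 sx).
    by have /andP[_] := dlI _ (Isub _ _ _ Is It xst); lra.
- have s0 := I0 _ Is; have := balance s t s0 st.
  have [cda' cdb' da0 db0] := speeds s t s0; have [ca cb ada adb] := chars s t s0.
  suff : fine (J (s + l s) (t + l t)) <= fine (J (s - l s) (t - l t)) by lra.
  apply: fine_le; [| by apply: Jfin; exact: subl_ge0|].
    by apply: Jfin; exact: le_trans (addl_ge0 _ s0).
  (* For [l' >= 0] the speeds satisfy [db <= da], so the two characteristics exchange roles. *)
  apply: (ge0_integral_flux_le (ltW st) cdb' cda' db0 da0 cb ca adb ada).
  + by apply: mdg; exact: subl_ge0.
  + by apply: mdg; exact: le_trans (addl_ge0 _ s0).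
  + have [N [mN N0 sub]] := flux s t s0 st; exists N; split => // x nx.
    by apply: sub => H; apply: nx => xst; rewrite (H xst) opprK.
  + move=> x; rewrite in_itv/= => xst; have [sx _] := andP xst.
    have [-> ->] := dabE _ (le_lt_trans s0 sx).
    by have /andP[+ _] := dlI _ (Isub _ _ _ Is It xst); lra.
Qed.
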